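(* Let $A$ be an associative ring, not necessarily commutative and not necessarily unital, and let $n\ge 2$. Then the assignment $y_i^a\mapsto x_{i\,i+1}^a\,y_i$ ($1\le i\le n-1$, $a\in A$) induces a well-defined map $$\phi: Br_n(A)\longrightarrow St_n(A)\rtimes Br_n,$$ and $\phi$ is an isomorphism of groups.
   Context: The parametrized braid group $Br_n(A)$ is the group generated by elements $y_i^a$, $1\le i\le n-1$, $a\in A$, subject to the relations, for all $a,b,c\in A$: (A1) $y_i^a y_i^0 y_i^b = y_i^0 y_i^0 y_i^{a+b}$; (A1$\times$A1) $y_i^a y_j^b = y_j^b y_i^a$ if $|i-j|\ge 2$; (A2) $y_i^a y_{i+1}^b y_i^c = y_{i+1}^c\, y_i^{b+ac}\, y_{i+1}^a$. $Br_n$ denotes the Artin braid group, with generators $y_1,\dots,y_{n-1}$ and relations $y_iy_j=y_jy_i$ for $|i-j|\ge2$ and $y_iy_{i+1}y_i=y_{i+1}y_iy_{i+1}$; it maps onto the symmetric group $\mathcal S_n$ via $y_i\mapsto$ the transposition $(i\ i+1)$. The Steinberg group $St_n(A)$ is generated by $x_{ij}^a$, $1\le i,j\le n$, $i\ne j$, $a\in A$, subject to: $x_{ij}^a x_{ij}^b = x_{ij}^{a+b}$; $x_{ij}^a x_{kl}^b = x_{kl}^b x_{ij}^a$ for $i\ne l$, $j\ne k$; $x_{ij}^a x_{jk}^b = x_{jk}^b x_{ik}^{ab} x_{ij}^a$ for $i\ne k$. The braid group $Br_n$ acts on $St_n(A)$ through $\mathcal S_n$ by $\sigma\cdot x_{ij}^a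 = x_{\sigma(i)\sigma(j)}^a$, and $St_n(A)\rtimes Br_n$ is the semidirect product for this action. *)

(* Defs.v *)
(* Groups given by presentations are encoded as setoids of
   words in the free monoid on generators-and-formal-inverses, modulo the
   congruence generated by free cancellation and the defining relations. *)
From mathcomp Require Import all_boot fingroup perm ssralg.
Set Implicit Arguments. Unset Strict Implicit. Unset Printing Implicit Defensive.
Import GRing.Theory.
Local Open Scope ring_scope.

(* A letter (g, false) is the generator g, (g, true) is g^-1. *)
Definition word (G : Type) := seq (G * bool).

Inductive pres_eq (G : Type) (R : word G -> word G -> Prop) :
    word G -> word G -> Prop :=
| pe_refl w : pres_eq R w w
| pe_sym u v : pres_eq R u v -> pres_eq R v u
| pe_trans u v w : pres_eq R u v -> pres_eq R v w -> pres_eq R u w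
| pe_cat u u' v v' : pres_eq R u u' -> pres_eq R v v' ->
    pres_eq R (u ++ v) (u' ++ v')
| pe_cancel g e : pres_eq R [:: (g, e); (g, ~~ e)] [::]
| pe_rel u v : R u v -> pres_eq R u v.

Definition winv (G : Type) (w : word G) : word G :=
  rev (map (fun l => (l.1, ~~ l.2)) w).

Section Groups.
Variable n : nat.

(* Indices: 'I_n = {0,...,n-1} stands for {1,...,n};
   i : 'I_n.-1 stands for the braid index i+1 in {1,...,n-1},
   the transposition (i i+1) acting on 'I_n. *)
Lemma succ_lt_pred (i : 'I_n.-1) : (i.+1 < n)%N.
Proof. by case: n i => [|m] [k Hk] //=. Qed.

Definition lo (i : 'I_n.-1) : 'I_n := widen_ord (leq_pred n) i.
Definition hi (i : 'I_n.-1) : 'I_n := Ordinal (succ_lt_pred i).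

Lemma lo_neq_hi (i : 'I_n.-1) : (lo i, hi i).1 != (lo i, hi i).2.
Proof. by rewrite /= -(inj_eq val_inj) /= neq_ltn ltnSn. Qed.

Definition transp (i : 'I_n.-1) : {perm 'I_n} := tperm (lo i) (hi i).

Section BrA.
Variables (A : zmodType) (mul : A -> A -> A).

Definition BrAgen := ('I_n.-1 * A)%type.
Definition yA (i : 'I_n.-1) (a : A) : BrAgen * bool := ((i, a), false).

Definition far (i j : 'I_n.-1) : bool := (i.+1 < j)%N || (j.+1 < i)%N.

Definition BrA_rel (u v : word BrAgen) : Prop :=
  (exists i a b, u = [:: yA i a; yA i 0; yA i b] /\
                 v = [:: yA i 0; yA i 0; yA i (a + b)])
  \/ (exists i j a b, far i j /\ u = [:: yA i a; yA j b] /\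
                                 v = [:: yA j b; yA i a])
  \/ (exists (i j : 'I_n.-1) a b c, val j = i.+1 :> nat /\
        u = [:: yA i a; yA j b; yA i c] /\
        v = [:: yA j c; yA i (b + mul a c); yA j a]).

Definition BrA_eq := pres_eq BrA_rel.

Definition Stidx := {ij : 'I_n * 'I_n | ij.1 != ij.2}.
Definition Stgen := (Stidx * A)%type.
Definition xA (p : Stidx) (a : A) : Stgen * bool := ((p, a), false).

Definition St_rel (u v : word Stgen) : Prop :=
  (exists p a b, u = [:: xA p a; xA p b] /\ v = [:: xA p (a + b)])
  \/ (exists (p q : Stidx) a b, (val p).1 != (val q).2 /\ (val p).2 != (val q).1 /\
        u = [:: xA p a; xA q b] /\ v = [:: xA q b; xA p a])
  \/ (exists (p q r : Stidx) a b, (val p).2 = (val q).1 /\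
        val r = ((val p).1, (val q).2) /\
        u = [:: xA p a; xA q b] /\ v = [:: xA q b; xA r (mul a b); xA p a]).

Definition St_eq := pres_eq St_rel.

Definition Br_rel (u v : word 'I_n.-1) : Prop :=
  (exists i j, far i j /\ u = [:: (i, false); (j, false)] /\
                          v = [:: (j, false); (i, false)])
  \/ (exists (i j : 'I_n.-1), val j = i.+1 :> nat /\
        u = [:: (i, false); (j, false); (i, false)] /\
        v = [:: (j, false); (i, false); (j, false)]).

Definition Br_eq := pres_eq Br_rel.

(* sigma . x_{ij}^a = x_{sigma(i) sigma(j)}^a  (the default of insubd is never
   used since sigma is injective) *)
Definition perm_gen (s : {perm 'I_n}) (g : Stgen) : Stgen :=
  (insubd g.1 (s (val g.1).1, s (val g.1).2), g.2).

(* image in S_n of a braid word, acting on the left: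
   y_{i1}^{e1} ... y_{ik}^{ek} |-> (i1 i1+1) o ... o (ik ik+1) *)
Definition act_gen (b : word 'I_n.-1) (g : Stgen) : Stgen :=
  foldr (fun l h => perm_gen (transp l.1) h) g b.

Definition act_word (b : word 'I_n.-1) (s : word Stgen) : word Stgen :=
  map (fun l => (act_gen b l.1, l.2)) s.

Definition SD := (word Stgen * word 'I_n.-1)%type.
Definition SD_eq (p q : SD) : Prop := St_eq p.1 q.1 /\ Br_eq p.2 q.2.
Definition SD_one : SD := ([::], [::]).
Definition SD_mul (p q : SD) : SD := (p.1 ++ act_word p.2 q.1, p.2 ++ q.2).
Definition SD_inv (p : SD) : SD := (act_word (winv p.2) (winv p.1), winv p.2).

Definition xpair (i : 'I_n.-1) : Stidx := exist _ (lo i, hi i) (lo_neq_hi i).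

Definition phi_gen (g : BrAgen) : SD :=
  ([:: xA (xpair g.1) g.2], [:: (g.1, false)]).

Definition phi_letter (l : BrAgen * bool) : SD :=
  if l.2 then SD_inv (phi_gen l.1) else phi_gen l.1.

Definition phi (w : word BrAgen) : SD :=
  foldr (fun l acc => SD_mul (phi_letter l) acc) SD_one w.

End BrA.
End Groups.

(* Main.v *)
(** Write s_i for y_i^0 and X_i(a) for y_i^a s_i^-1.  Setting parameters to 0
    in the defining relations of Br_n(A) shows that the s_i satisfy the braid
    relations, that each X_i is additive, and that conjugation by the s_k
    permutes the X_i as in the semidirect product: s_k fixes X_i when k and i
    are far apart, s_i^2 fixes X_i, s_i s_{i+1} carries X_i to X_{i+1},
    s_{i+1} s_i carries X_{i+1} to X_i, and s_{i+1}, s_i carry X_i, X_{i+1} to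
    the same element.  These rules alone force the orbit of X_i(a) under
    conjugation by the s_k to be indexed by the pairs (i, j), i <> j, with s_k
    acting through the transposition (k k+1).  As the symmetric group is
    transitive on tuples of distinct indices, each Steinberg relation needs to
    be checked only on the first indices, where it is a case of (A2), (A1) or
    (A1xA1).  This yields an inverse of phi. *)
Require Import Defs.
From Stdlib Require Import Setoid Morphisms.
From mathcomp Require Import all_boot fingroup perm ssralg zify.
Set Implicit Arguments. Unset Strict Implicit. Unset Printing Implicit Defensive.
Import GRing.Theory.
Local Open Scope ring_scope.

#[local] Hint Resolve pe_refl : core.

(** * Group structure on words modulo a presentation, and conjugation in it *)

Section PresentedGroup.
Variables (G : Type) (R : word G -> word G -> Prop).
Local Notation "u ~ v" := (pres_eq R u v) (at level 70).

#[export] Instance pres_eq_equivalence : Equivalence (pres_eq R).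
Proof.
split; [exact: pe_refl | exact: pe_sym | move=> u v w; exact: pe_trans].
Qed.

#[export] Instance cat_pres_eq :
  Proper (pres_eq R ==> pres_eq R ==> pres_eq R) (@cat (G * bool)).
Proof. by move=> u u' uu' v v' vv'; apply: pe_cat. Qed.

Lemma winv_cat (u v : word G) : winv (u ++ v) = winv v ++ winv u.
Proof. by rewrite /winv map_cat rev_cat. Qed.

Lemma winvK : involutive (@winv G).
Proof.
move=> u; rewrite /winv map_rev revK -map_comp.
by rewrite (eq_map (g := id)) ?map_id // => -[g e] /=; rewrite negbK.
Qed.

Lemma mulwV (u : word G) : u ++ winv u ~ [::].
Proof.
elim: u => [|[g e] u IH] //.
rewrite -cat1s winv_cat -catA (catA u) IH; exact: pe_cancel.
Qed.

Lemma mulVw (u : word G) : winv u ++ u ~ [::].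
Proof. by have := mulwV (winv u); rewrite winvK. Qed.

Lemma mulKw (u v : word G) : winv u ++ (u ++ v) ~ v.
Proof. by rewrite catA mulVw. Qed.

Lemma mulVKw (u v : word G) : u ++ (winv u ++ v) ~ v.
Proof. by rewrite catA mulwV. Qed.

Lemma wcancel_l (u v w : word G) : u ++ v ~ u ++ w -> v ~ w.
Proof. by move=> uvw; rewrite -(mulKw u v) uvw mulKw. Qed.

Lemma wcancel_r (u v w : word G) : v ++ u ~ w ++ u -> v ~ w.
Proof.
move=> vuw; have : (v ++ u) ++ winv u ~ (w ++ u) ++ winv u by rewrite vuw.
by rewrite -!catA mulwV !cats0.
Qed.

(** The congruence has no closure rule for inverses; uniqueness of inverses supplies it. *)
#[export] Instance winv_pres_eq : Proper (pres_eq R ==> pres_eq R) (@winv G).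
Proof.
by move=> u v uv; apply: (@wcancel_l u); rewrite mulwV uv mulwV.
Qed.

Definition cj (g u : word G) : word G := g ++ u ++ winv g.

#[export] Instance cj_pres_eq :
  Proper (pres_eq R ==> pres_eq R ==> pres_eq R) cj.
Proof. by move=> g g' gg' u v uv; rewrite /cj gg' uv. Qed.

Lemma cj_cat (g h u : word G) : cj (g ++ h) u = cj g (cj h u).
Proof. by rewrite /cj winv_cat -!catA. Qed.

Lemma cjM (g u v : word G) : cj g (u ++ v) ~ cj g u ++ cj g v.
Proof. by rewrite /cj -!catA mulKw. Qed.

Lemma cjV (g u : word G) : cj g (winv u) = winv (cj g u).
Proof. by rewrite /cj !winv_cat winvK catA. Qed.

Lemma cj_winv (g u v : word G) : cj g u ~ v -> cj (winv g) v ~ u.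
Proof. by move<-; rewrite -cj_cat mulVw /cj cats0. Qed.

(** Trades a conjugation for an identity without inverses, the shape of the defining relations. *)
Lemma cjP (g u v : word G) : cj g u ~ v <-> g ++ u ~ v ++ g.
Proof.
split=> [<-|guv]; first by rewrite /cj -!catA mulVw cats0.
by rewrite /cj catA guv -catA mulwV cats0.
Qed.

Lemma cj_mul (g u v : word G) : g ++ u ++ v ~ cj g u ++ g ++ v.
Proof. by rewrite /cj -!catA mulKw. Qed.

Lemma cj_inj (g u v : word G) : cj g u ~ cj g v -> u ~ v.
Proof. by move/wcancel_l/wcancel_r. Qed.

End PresentedGroup.

(** * Homomorphisms out of a presented group *)

Section WordMap.
Variables (G H : Type) (f : G -> word H).

Definition wmap (w : word G) : word H :=
  flatten [seq if l.2 then winv (f l.1) else f l.1 | l <- w].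

Lemma wmap_cat (u v : word G) : wmap (u ++ v) = wmap u ++ wmap v.
Proof. by rewrite /wmap map_cat flatten_cat. Qed.

Lemma wmap1 (g : G) : wmap [:: (g, false)] = f g.
Proof. by rewrite /wmap /= cats0. Qed.

Lemma wmap_cons (l : G * bool) (w : word G) : wmap (l :: w) = wmap [:: l] ++ wmap w.
Proof. exact: (wmap_cat [:: l]). Qed.

Lemma wmap_winv (w : word G) : wmap (winv w) = winv (wmap w).
Proof.
elim: w => [|[g e] w IH] //.
rewrite -cat1s winv_cat !wmap_cat winv_cat IH; congr (_ ++ _).
by rewrite /wmap /=; case: e; rewrite /= !cats0 ?winvK.
Qed.

(** Universal property of a presentation: free cancellation survives in any target, so only the
    defining relations need checking. *)
Lemma wmap_pres_eq (R : word G -> word G -> Prop) (S : word H -> word H -> Prop) :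
  (forall u v, R u v -> pres_eq S (wmap u) (wmap v)) ->
  forall u v, pres_eq R u v -> pres_eq S (wmap u) (wmap v).
Proof.
move=> RS u v; elim=> {u v} [w|u v _ IH|u v w _ IHu _ IHv|u u' v v' _ IHu _ IHv|g e|u v].
- exact: pe_refl.
- exact: pe_sym.
- exact: pe_trans IHv.
- by rewrite !wmap_cat IHu IHv.
- have -> : [:: (g, e); (g, ~~ e)] = [:: (g, e)] ++ winv [:: (g, e)] by [].
  by rewrite wmap_cat wmap_winv mulwV.
- exact: RS.
Qed.

End WordMap.

(** * Braid operators and the elements they attach to pairs of strands *)

Definition tnat (k i : nat) : nat :=
  if i == k then k.+1 else if i == k.+1 then k else i.

Section BraidAction.
Variables (T : Type) (e : T -> T -> Prop) (c : nat -> T -> T) (N : nat).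
Context {e_equiv : Equivalence e} {c_proper : forall k, Proper (e ==> e) (c k)}.
Local Notation "u ~ v" := (e u v) (at level 70).
Hypothesis c_far : forall k l t, (k.+1 < l < N)%N -> c k (c l t) ~ c l (c k t).
Hypothesis c_braid : forall k t, (k.+1 < N)%N ->
  c k (c k.+1 (c k t)) ~ c k.+1 (c k (c k.+1 t)).

Lemma c_comm k l t : (k < N)%N -> (l < N)%N -> (k.+1 < l)%N || (l.+1 < k)%N ->
  c k (c l t) ~ c l (c k t).
Proof. by move=> kN lN /orP[] kl; [|symmetry]; apply: c_far; lia. Qed.

Section Strands.
(** The family stays abstract because it is instantiated twice: by [x] for increasing pairs and by
    [xopp] for decreasing ones. *)
Variable z : nat -> T.
Hypothesis z_far : forall k i, (k < N)%N -> (i < N)%N ->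
  (k.+1 < i)%N || (i.+1 < k)%N -> c k (z i) ~ z i.
Hypothesis z_next : forall i, (i.+1 < N)%N -> c i.+1 (z i) ~ c i (z i.+1).
Hypothesis z_sqr : forall i, (i.+1 < N)%N -> c i.+1 (c i.+1 (z i)) ~ z i.
Hypothesis z_sql : forall i, (i.+1 < N)%N -> c i (c i (z i.+1)) ~ z i.+1.

(* The element carried by the pair of strands (i, i + d + 1). *)
Fixpoint strand (i d : nat) : T :=
  if d is d'.+1 then c (i + d) (strand i d') else z i.

Lemma strand_far k i d : (k < N)%N -> (i + d < N)%N ->
  (k.+1 < i)%N || (i + d.+1 < k)%N -> c k (strand i d) ~ strand i d.
Proof.
move=> kN; elim: d => [|d IH] iN ki /=; first by apply: z_far; lia.
by rewrite c_comm ?IH; try lia; reflexivity.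
Qed.

(** The pair can equally be lengthened at its lower end: [c i] commutes with the upper operators
    until only [z_next] is left. *)
Lemma strand_lo i d : (i + d.+1 < N)%N -> strand i d.+1 ~ c i (strand i.+1 d).
Proof.
elim: d => [|d IH] iN; first by rewrite /= addn1; apply: z_next; lia.
rewrite -[strand i d.+2]/(c (i + d.+2) (strand i d.+1)) IH; last lia.
rewrite c_comm; try lia.
by rewrite /= addSnnS; reflexivity.
Qed.

Lemma strand_hi_sq i d : (i + d.+1 < N)%N ->
  c (i + d.+1) (c (i + d.+1) (strand i d)) ~ strand i d.
Proof.
elim: d i => [|d IH] i iN; first by rewrite /= addn1; apply: z_sqr; lia.
rewrite strand_lo; last lia.
rewrite (c_comm (l := i)); try lia.
rewrite (c_comm (l := i)); try lia.
by rewrite -addSnnS IH; [reflexivity | lia].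
Qed.

Lemma strand_lo_sq i d : (i.+1 + d < N)%N ->
  c i (c i (strand i.+1 d)) ~ strand i.+1 d.
Proof.
elim: d => [|d IH] iN /=; first by apply: z_sql; lia.
rewrite (c_comm (k := i)); try lia.
rewrite (c_comm (k := i)); try lia.
by rewrite IH; [reflexivity | lia].
Qed.

(** Far commutation settles everything except [k = i + d - 1]. There the braid relation brings
    [c k.+1] innermost, where it fixes a strand that ends below it. *)
Lemma strand_mid k i d : (i + d < N)%N -> (i < k < i + d)%N ->
  c k (strand i d) ~ strand i d.
Proof.
elim: d => [|d IH] iN ki; first lia.
have [kd|kd] := ltnP k (i + d).
  by rewrite /= c_comm ?IH; try lia; reflexivity.
case: d => [|d] in IH iN ki kd *; first lia.
have -> : k = (i + d.+1)%N by lia.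
rewrite /= (addnS i d.+1) c_braid; last lia.
by rewrite (strand_far (k := (i + d.+1).+1)); try lia; reflexivity.
Qed.

(** The excluded case is the one where the transposition reverses the pair. The others are sorted by
    which of [k], [k.+1] meets [i] or [j]. *)
Lemma strand_tnat k i j : (k < N)%N -> (i < j <= N)%N -> (k != i) || (j != i.+1) ->
  c k (strand i (j - i.+1)) ~ strand (tnat k i) (tnat k j - (tnat k i).+1).
Proof.
move=> kN ijN kij; rewrite /tnat.
have [ik|ik] := eqVneq i k.
  have -> : (j == k) = false by lia.
  have -> : (j == k.+1) = false by lia.
  subst k; have -> : (j - i.+1 = (j - i.+2).+1)%N by lia.
  rewrite strand_lo; last lia.
  by apply: strand_lo_sq; lia.
have [ik1|ik1] := eqVneq i k.+1.
  have -> : (j == k) = false by lia.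
  have -> : (j == k.+1) = false by lia.
  subst i; have -> : (j - k.+1 = (j - k.+2).+1)%N by lia.
  by rewrite strand_lo; [reflexivity | lia].
have [jk|jk] := eqVneq j k.
  subst j; have -> : (k.+1 - i.+1 = (k - i.+1).+1)%N by lia.
  have -> : strand i (k - i.+1).+1 = c (i + (k - i.+1).+1) (strand i (k - i.+1)) by [].
  have -> : (i + (k - i.+1).+1 = k)%N by lia.
  reflexivity.
have [jk1|jk1] := eqVneq j k.+1.
  subst j; have -> : (k.+1 - i.+1 = (k - i.+1).+1)%N by lia.
  rewrite /=; have {1}-> : k = (i + (k - i.+1).+1)%N by lia.
  by apply: strand_hi_sq; lia.
have [kij'|kij'] := boolP ((i < k) && (k < i + (j - i.+1)))%N.
  by apply: strand_mid; lia.
by apply: strand_far; lia.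
Qed.

End Strands.

Variable x : nat -> T.
Hypothesis x_far : forall k i, (k < N)%N -> (i < N)%N ->
  (k.+1 < i)%N || (i.+1 < k)%N -> c k (x i) ~ x i.
Hypothesis x_sq : forall i, (i < N)%N -> c i (c i (x i)) ~ x i.
Hypothesis x_next : forall i, (i.+1 < N)%N -> c i.+1 (x i) ~ c i (x i.+1).
Hypothesis x_up : forall i, (i.+1 < N)%N -> c i (c i.+1 (x i)) ~ x i.+1.
Hypothesis x_down : forall i, (i.+1 < N)%N -> c i.+1 (c i (x i.+1)) ~ x i.

(** The element of the reversed adjacent pair (i+1, i). *)
Definition xopp (i : nat) : T := c i (x i).

Lemma x_sqr i : (i.+1 < N)%N -> c i.+1 (c i.+1 (x i)) ~ x i.
Proof. by move=> iN; rewrite x_next // x_down //; reflexivity. Qed.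

Lemma x_sql i : (i.+1 < N)%N -> c i (c i (x i.+1)) ~ x i.+1.
Proof. by move=> iN; rewrite -x_next // x_up //; reflexivity. Qed.

Lemma xopp_far k i : (k < N)%N -> (i < N)%N ->
  (k.+1 < i)%N || (i.+1 < k)%N -> c k (xopp i) ~ xopp i.
Proof. by move=> *; rewrite /xopp c_comm // x_far //; reflexivity. Qed.

(** Expanding [x i] by [x_down] and braiding puts [c i] twice next to [x i.+1], where [x_sql]
    removes it. *)
Lemma xopp_next i : (i.+1 < N)%N -> c i.+1 (xopp i) ~ c i (xopp i.+1).
Proof.
move=> iN; rewrite /xopp -{1}(x_down iN) -c_braid //.
by rewrite (x_sql iN); reflexivity.
Qed.

Lemma xopp_sqr i : (i.+1 < N)%N -> c i.+1 (c i.+1 (xopp i)) ~ xopp i.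
Proof.
move=> iN; rewrite xopp_next // /xopp -c_braid //.
by rewrite -x_next // x_sqr //; reflexivity.
Qed.

Lemma xopp_sql i : (i.+1 < N)%N -> c i (c i (xopp i.+1)) ~ xopp i.+1.
Proof.
move=> iN; rewrite -xopp_next // /xopp c_braid //.
by rewrite x_next // x_sql //; reflexivity.
Qed.

Definition pair_elt (i j : nat) : T :=
  if (i < j)%N then strand x i (j - i.+1) else strand xopp j (i - j.+1).

Lemma pair_elt_tnat k i j : (k < N)%N -> (i <= N)%N -> (j <= N)%N -> i != j ->
  c k (pair_elt i j) ~ pair_elt (tnat k i) (tnat k j).
Proof.
move=> kN iN jN ij; rewrite /pair_elt.
have [lt_ij|le_ji] := ltnP i j.
  (* The pair (k, k+1) is reversed; this is the definition of [xopp]. *)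
  have [/andP[/eqP-> /eqP->]|kij] := boolP ((k == i) && (j == i.+1)).
    rewrite /tnat !eqxx eqn_leq ltnn /= ltnNge leqnSn /= !subnn; reflexivity.
  have -> : (tnat k i < tnat k j)%N by rewrite /tnat; repeat case: ifP; lia.
  apply: strand_tnat; [exact: x_far|exact: x_next|exact: x_sqr|exact: x_sql|done|lia|lia].
(* The pair (k+1, k) is turned back, which is [x_sq]. *)
have [/andP[/eqP-> /eqP->]|kij] := boolP ((k == j) && (i == j.+1)).
  rewrite /tnat !eqxx eqn_leq ltnn /= ltnSn !subnn /= /xopp; apply: x_sq; lia.
have -> : (tnat k i < tnat k j)%N = false by rewrite /tnat; repeat case: ifP; lia.
apply: strand_tnat; [exact: xopp_far|exact: xopp_next|exact: xopp_sqr|exact: xopp_sql|done|lia|lia].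
Qed.

End BraidAction.

(** Conjugation is an automorphism, so equivariance on generators passes to words. *)
Lemma cj_wmap (G H : Type) (R : word H -> word H -> Prop) (f : G -> word H)
    (h : G -> G) (w : word H) :
  (forall g, pres_eq R (cj w (f g)) (f (h g))) ->
  forall u, pres_eq R (cj w (wmap f u)) (wmap f [seq (h l.1, l.2) | l <- u]).
Proof.
move=> wf; elim=> [|[g e] u IH] /=; first by rewrite /cj /= mulwV.
rewrite wmap_cons (wmap_cons _ (_, _)) cjM IH.
by rewrite /wmap /=; case: e; rewrite /= !cats0 ?cjV wf.
Qed.

(** * Adjacent transpositions, and transitivity of the symmetric group on tuples *)

Lemma transp_val n (k : 'I_n.-1) (i : 'I_n) : transp k i = tnat k i :> nat.
Proof.
rewrite /transp /tnat; case: tpermP => [->|->|/eqP ik /eqP ik1] /=.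
- by rewrite eqxx.
- by rewrite eqxx; case: eqP => //; lia.
- by rewrite -val_eqE /= in ik; rewrite -val_eqE /= in ik1; rewrite (negPf ik) (negPf ik1).
Qed.

(** Adjacent transpositions generate: by induction on the distance, (x y) is the conjugate of (x
    y-1) by (y-1 y). *)
Lemma transp_ind m (P : {perm 'I_m.+2} -> Prop) :
  P 1%g -> (forall s t, P s -> P t -> P (s * t)%g) -> (forall k, P (transp k)) ->
  forall s, P s.
Proof.
move=> P1 PM Pt.
have Plt d (x y : 'I_m.+2) : y = (x + d.+1)%N :> nat -> P (tperm x y).
  elim: d y => [|d IH] y yx.
    have xm : (x < m.+1)%N by have := ltn_ord y; lia.
    suff -> : tperm x y = transp (Ordinal xm : 'I_m.+2.-1) by [].
    by congr tperm; apply: val_inj => //=; lia.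
  have ym : (x + d.+1 < m.+1)%N by have := ltn_ord y; lia.
  pose k : 'I_m.+2.-1 := Ordinal ym.
  have -> : tperm x y = (transp k * tperm x (lo k) * transp k)%g.
    have tV : (transp k)^-1%g = transp k by apply: tpermV.
    rewrite -{1}tV -mulgA -conjgE tpermJ; congr tperm.
      by apply: ord_inj; rewrite transp_val /tnat /=; do ! case: eqP; lia.
    by apply: ord_inj; rewrite transp_val /tnat /= eqxx; lia.
  by apply: (PM) => //; apply: (PM) => //; apply: IH.
have Ptp (x y : 'I_m.+2) : P (tperm x y).
  have [xy|yx|/val_inj->] := ltngtP x y; last by rewrite tperm1.
    by apply: (Plt (y - x.+1)%N); lia.
  by rewrite tpermC; apply: (Plt (x - y.+1)%N); lia.
move=> s; have [ts -> _] := prod_tpermP s.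
by elim/big_rec: _ => // t s' _; apply: PM.
Qed.

Lemma perm_to_iota n (t : seq 'I_n) : uniq t ->
  exists s : {perm 'I_n}, [seq val (s i) | i <- t] = iota 0 (size t).
Proof.
elim/last_ind: t => [|t x IH]; first by exists 1%g.
move=> ut; move: (ut); rewrite rcons_uniq => /andP[xt /IH[s st]].
have lt_n : (size t < n)%N.
  by move/card_uniqP: ut; rewrite size_rcons => <-; rewrite -[leqRHS]card_ord max_card.
pose y := Ordinal lt_n.
(* The extra transposition puts [x] at position [size t] and moves none of the values already
   placed, all of which are smaller than [size t] and differ from [s x]. *)
exists (s * tperm (s x) y)%g.
rewrite map_rcons permM tpermL size_rcons -addn1 iotaD /= add0n cats1; congr rcons.
rewrite -st; apply/eq_in_map => i it; rewrite permM tpermD //.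
  by rewrite (inj_eq perm_inj); apply: contraNneq xt => ->.
apply/eqP=> /(congr1 val) /= yi.
have : val (s i) \in iota 0 (size t) by rewrite -st; apply: map_f.
by rewrite mem_iota /= -yi; lia.
Qed.

(** * The action of braids on the Steinberg group *)

Section SteinbergAction.
Variables (n : nat) (A : zmodType) (mul : A -> A -> A).
Implicit Types (g : Stgen n A) (s t : {perm 'I_n}) (b : word 'I_n.-1).

Definition perm_idx s (p : Stidx n) : Stidx n := insubd p (s (val p).1, s (val p).2).

Lemma perm_idxE s p : val (perm_idx s p) = (s (val p).1, s (val p).2).
Proof. by rewrite insubdK //= -topredE /= (inj_eq perm_inj); case: p. Qed.

Lemma perm_idxM s t p : perm_idx s (perm_idx t p) = perm_idx (t * s)%g p.
Proof. by apply: val_inj; rewrite !perm_idxE /= !permM. Qed.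

Lemma perm_idx1 p : perm_idx 1%g p = p.
Proof. by apply: val_inj; rewrite perm_idxE !perm1; case: (val p). Qed.

Lemma perm_genE s p (a : A) : perm_gen s (p, a) = (perm_idx s p, a).
Proof. by []. Qed.

Lemma perm_gen1 g : perm_gen 1%g g = g.
Proof. by case: g => p a; rewrite perm_genE perm_idx1. Qed.

Lemma perm_genM s t g : perm_gen s (perm_gen t g) = perm_gen (t * s)%g g.
Proof. by case: g => p a; rewrite !perm_genE perm_idxM. Qed.

(** Permutation products apply their left factor first, so the factors are reversed to obtain a left
    action. *)
Definition bperm b : {perm 'I_n} := foldr (fun l s => s * transp l.1)%g 1%g b.

Lemma act_genE b g : act_gen b g = perm_gen (bperm b) g.
Proof. by elim: b => [|l b IH] /=; rewrite ?perm_gen1 // IH perm_genM. Qed.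

Lemma bperm_cat b b' : bperm (b ++ b') = (bperm b' * bperm b)%g.
Proof. by elim: b => [|l b IH] /=; rewrite ?mulg1 // IH mulgA. Qed.

Lemma transp_far (i j : 'I_n.-1) : far i j -> (transp i * transp j = transp j * transp i)%g.
Proof.
rewrite /far => ij; apply/permP=> x; apply: ord_inj.
by rewrite !permM !transp_val /tnat; repeat case: ifP; lia.
Qed.

Lemma transp_braid (i j : 'I_n.-1) : val j = i.+1 :> nat ->
  (transp i * (transp j * transp i) = transp j * (transp i * transp j))%g.
Proof.
move=> /= ij; apply/permP=> x; apply: ord_inj.
by rewrite !permM !transp_val /tnat; repeat case: ifP; lia.
Qed.

(** The signs of letters are ignored by [bperm]; cancellation holds because transpositions are
    involutions. *)
Lemma bperm_eq b b' : Br_eq b b' -> bperm b = bperm b'.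
Proof.
elim=> {b b'} [//|b b' _ -> //|b1 b2 b3 _ -> _ -> //|b1 b1' b2 b2' _ IH1 _ IH2|i e|b b'].
- by rewrite !bperm_cat IH1 IH2.
- by rewrite /= mul1g tperm2.
case=> [[i [j [ij [-> ->]]]]|[i [j [ij [-> ->]]]]] /=; rewrite !mul1g.
  by rewrite (transp_far ij).
by rewrite -!mulgA transp_braid.
Qed.

Lemma act_word_cat b b' (u : word (Stgen n A)) :
  act_word (b ++ b') u = act_word b (act_word b' u).
Proof.
by rewrite /act_word -map_comp; apply: eq_map => l; rewrite /= /act_gen foldr_cat.
Qed.

Lemma act_word_mul b (u v : word (Stgen n A)) :
  act_word b (u ++ v) = act_word b u ++ act_word b v.
Proof. exact: map_cat. Qed.

Lemma act_word_nil (u : word (Stgen n A)) : act_word [::] u = u.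
Proof. by elim: u => //= -[g e] u {1}->. Qed.

Lemma act_word_br b b' (u : word (Stgen n A)) : Br_eq b b' -> act_word b u = act_word b' u.
Proof. by move=> bb'; apply: eq_map => l; rewrite !act_genE (bperm_eq bb'). Qed.

(** Permutations are injective, so they preserve the side conditions of each Steinberg relation. *)
Lemma act_word_St b (u v : word (Stgen n A)) :
  St_eq mul u v -> St_eq mul (act_word b u) (act_word b v).
Proof.
elim=> {u v} [w|u v _ IH|u v w _ IHu _ IHv|u u' v v' _ IHu _ IHv|g e|u v uv].
- exact: pe_refl.
- exact: pe_sym.
- exact: pe_trans IHv.
- by rewrite !act_word_mul; apply: pe_cat.
- exact: pe_cancel.
apply: pe_rel; rewrite /act_word; set s := bperm b.
case: uv => [[p [a [c [-> ->]]]]|[[p [q [a [c [pq [qp [-> ->]]]]]]]|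
             [p [q [r [a [c [pq [rE [-> ->]]]]]]]]]] /=; rewrite !act_genE !perm_genE -/s.
- by left; exists (perm_idx s p), a, c.
- right; left; exists (perm_idx s p), (perm_idx s q), a, c.
  by rewrite !perm_idxE /= !(inj_eq perm_inj).
- right; right; exists (perm_idx s p), (perm_idx s q), (perm_idx s r), a, c.
  by rewrite !perm_idxE /= pq rE.
Qed.

Lemma St_add (p : Stidx n) (a b : A) : St_eq mul [:: xA p a; xA p b] [:: xA p (a + b)].
Proof. by apply: pe_rel; left; exists p, a, b. Qed.

Lemma St_x0 (p : Stidx n) : St_eq mul [:: xA p 0] [::].
Proof.
apply: (@wcancel_l _ _ [:: xA p 0]); rewrite cats0.
by have := St_add p 0 0; rewrite addr0.
Qed.

Lemma St_comm (p q : Stidx n) (a b : A) : (val p).1 != (val q).2 -> (val p).2 != (val q).1 ->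
  St_eq mul [:: xA p a; xA q b] [:: xA q b; xA p a].
Proof. by move=> *; apply: pe_rel; right; left; exists p, q, a, b. Qed.

Lemma St_commutator (p q r : Stidx n) (a b : A) :
    (val p).2 = (val q).1 -> val r = ((val p).1, (val q).2) ->
  St_eq mul [:: xA p a; xA q b] [:: xA q b; xA r (mul a b); xA p a].
Proof. by move=> *; apply: pe_rel; right; right; exists p, q, r, a, b. Qed.

End SteinbergAction.

(** * The semidirect product, and [phi] as a homomorphism into it *)

Section SemidirectProduct.
Variables (n : nat) (A : zmodType) (mul : A -> A -> A).
Implicit Types p q r : SD n A.

Lemma SD_eq_refl p : SD_eq mul p p.
Proof. by split; apply: pe_refl. Qed.

Lemma SD_eq_sym p q : SD_eq mul p q -> SD_eq mul q p.
Proof. by case=> p1 p2; split; apply: pe_sym. Qed.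

Lemma SD_eq_trans p q r : SD_eq mul p q -> SD_eq mul q r -> SD_eq mul p r.
Proof. by move=> [p1 p2] [q1 q2]; split; [apply: pe_trans q1|apply: pe_trans q2]. Qed.

#[export] Instance SD_eq_equivalence : Equivalence (@SD_eq n A mul).
Proof. by split; [exact: SD_eq_refl|exact: SD_eq_sym|exact: SD_eq_trans]. Qed.

#[export] Instance SD_mul_SD_eq :
  Proper (@SD_eq n A mul ==> @SD_eq n A mul ==> @SD_eq n A mul) (@SD_mul n A).
Proof.
move=> p p' [pp1 pp2] q q' [qq1 qq2]; split; last exact: pe_cat.
by apply: pe_cat => //=; rewrite (act_word_br _ pp2); apply: act_word_St.
Qed.

Lemma SD_mulA p q r : SD_mul p (SD_mul q r) = SD_mul (SD_mul p q) r.
Proof. by rewrite /SD_mul /= act_word_mul act_word_cat !catA. Qed.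

Lemma SD_mul1p p : SD_mul (SD_one n A) p = p.
Proof. by rewrite /SD_mul /= act_word_nil; case: p. Qed.

Lemma SD_mulp1 p : SD_mul p (SD_one n A) = p.
Proof. by rewrite /SD_mul /= !cats0; case: p. Qed.

Lemma SD_mulpV p : SD_eq mul (SD_mul p (SD_inv p)) (SD_one n A).
Proof.
split=> /=; last exact: mulwV.
by rewrite -act_word_cat (act_word_br _ (mulwV _ _)) act_word_nil; apply: mulwV.
Qed.

Lemma SD_mulVp p : SD_eq mul (SD_mul (SD_inv p) p) (SD_one n A).
Proof.
split=> /=; last exact: mulVw.
by rewrite -act_word_mul -[X in St_eq _ _ X]/(act_word (winv p.2) [::]);
  apply/act_word_St/mulVw.
Qed.

Lemma phi_cat (u v : word (BrAgen n A)) : phi (u ++ v) = SD_mul (phi u) (phi v).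
Proof. by elim: u => [|l u IH] /=; rewrite ?SD_mul1p // IH SD_mulA. Qed.

Lemma phi_rel (u v : word (BrAgen n A)) : BrA_rel mul u v -> SD_eq mul (phi u) (phi v).
Proof.
case=> [[i [a [b [-> ->]]]]|[[i [j [a [b [ij [-> ->]]]]]]|
        [i [j [a [b [c [/= ij [-> ->]]]]]]]]]; rewrite /phi /=.
- rewrite !SD_mulp1 /SD_mul /=; split=> /=; last exact: pe_refl.
  rewrite /xA !perm_genE -!/(xA _ _).
  have x0 := @St_x0 n A mul; have xD := @St_add n A mul.
  (* Here [p] is (i, i+1) and [q] is (i+1, i); the factors with parameter 0 vanish. *)
  rewrite perm_idxM tperm2 perm_idx1; set p := xpair i; set q := perm_idx _ _.
  apply: pe_trans (_ : St_eq mul [:: xA p (a + b)] _).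
    rewrite -(xD p a b).
    exact: (pe_cat (pe_refl _ [:: xA p a]) (pe_cat (x0 q) (pe_refl _ [:: xA p b]))).
  apply: pe_sym.
  exact: (pe_cat (x0 p) (pe_cat (x0 q) (pe_refl _ [:: xA p (a + b)]))).
- rewrite !SD_mulp1 /SD_mul /=; split=> /=; last by apply: pe_rel; left; exists i, j.
  rewrite /xA !perm_genE -!/(xA _ _).
  have fixed (k l : 'I_n.-1) : far k l -> perm_idx (transp k) (xpair l) = xpair l.
    rewrite /far => kl; apply: val_inj; rewrite perm_idxE /=.
    by congr pair; apply: ord_inj; rewrite transp_val /tnat /=; repeat case: ifP; lia.
  rewrite !fixed //; last by rewrite /far orbC.
  by rewrite /far in ij; apply: St_comm; rewrite -val_eqE /=; lia.
- rewrite !SD_mulp1 /SD_mul /=; split=> /=; last by apply: pe_rel; right; exists i, j.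
  rewrite /xA !perm_genE -!/(xA _ _).
  (* These are the pairs (i, i+1), (i+1, i+2) and (i, i+2). The Steinberg part of (A2) becomes x_p^a
     x_r^b x_q^c = x_q^c x_r^{b+ac} x_p^a. *)
  set p := xpair i; set q := xpair j; set r := perm_idx (transp i) q.
  have qE : perm_idx (transp i) (perm_idx (transp j) p) = q.
    apply: val_inj; rewrite !perm_idxE /=.
    by congr pair; apply: ord_inj; rewrite !transp_val /tnat /=; repeat case: ifP; lia.
  have pE : perm_idx (transp j) (perm_idx (transp i) q) = p.
    apply: val_inj; rewrite !perm_idxE /=.
    by congr pair; apply: ord_inj; rewrite !transp_val /tnat /=; repeat case: ifP; lia.
  have rE : val r = (lo i, hi j).
    rewrite !perm_idxE /=.
    by congr pair; apply: ord_inj; rewrite !transp_val /tnat /=; repeat case: ifP; lia.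
  have rE' : perm_idx (transp j) p = r.
    apply: val_inj; rewrite rE !perm_idxE /=.
    by congr pair; apply: ord_inj; rewrite !transp_val /tnat /=; repeat case: ifP; lia.
  rewrite qE pE rE'.
  have pr x y : St_eq mul [:: xA p x; xA r y] [:: xA r y; xA p x].
    by apply: St_comm; rewrite rE -val_eqE /=; lia.
  have rq x y : St_eq mul [:: xA r x; xA q y] [:: xA q y; xA r x].
    by apply: St_comm; rewrite rE -val_eqE /=; lia.
  have pq : St_eq mul [:: xA p a; xA q c] [:: xA q c; xA r (mul a c); xA p a].
    by apply: St_commutator; rewrite ?rE //; apply: val_inj; rewrite /= ij.
  (* Move x_r^b to the front, let x_p^a cross x_q^c at the cost of x_r^{ac}, then bring x_r^b back
     past x_q^c to merge with it. *)
  rewrite -[[:: xA p a; _; _]]/([:: xA p a; xA r b] ++ [:: xA q c]) pr.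
  rewrite -[_ ++ _]/([:: xA r b] ++ [:: xA p a; xA q c]) pq.
  rewrite -[_ ++ _]/([:: xA r b; xA q c] ++ [:: xA r (mul a c); xA p a]) rq.
  rewrite -[_ ++ _]/([:: xA q c] ++ [:: xA r b; xA r (mul a c)] ++ [:: xA p a]).
  by rewrite St_add.
Qed.

Lemma phi_eq (u v : word (BrAgen n A)) : BrA_eq mul u v -> SD_eq mul (phi u) (phi v).
Proof.
elim=> {u v} [w|u v _ IH|u v w _ IHu _ IHv|u u' v v' _ IHu _ IHv|g e|u v].
- exact: SD_eq_refl.
- exact: SD_eq_sym.
- exact: SD_eq_trans IHv.
- by rewrite !phi_cat IHu IHv; reflexivity.
- by rewrite /phi /= SD_mulp1 /phi_letter; case: e; [apply: SD_mulVp|apply: SD_mulpV].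
- exact: phi_rel.
Qed.

End SemidirectProduct.

(** * Relations among s_k and X_k(a) in the parametrized braid group *)

Section Inverse.
Variables (m : nat) (A : zmodType) (mul : A -> A -> A).
Hypotheses (mulDl : left_distributive mul +%R) (mulDr : right_distributive mul +%R).
Local Notation "u ~ v" := (pres_eq (@BrA_rel m.+2 A mul) u v) (at level 70).

Let mulz_l a : mul 0 a = 0.
Proof. by apply: (addrI (mul 0 a)); rewrite -mulDl !addr0. Qed.

Let mulz_r a : mul a 0 = 0.
Proof. by apply: (addrI (mul a 0)); rewrite -mulDr !addr0. Qed.

(** Natural indices fit the abstract braid operators; [inord] is faithful only for [k < m.+1],
    whence the bounds wherever distinct indices interact. *)
Definition y (k : nat) (a : A) : word (BrAgen m.+2 A) :=
  [:: yA (inord k : 'I_m.+2.-1) a].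

Lemma y_A1 k a b : y k a ++ y k 0 ++ y k b ~ y k 0 ++ y k 0 ++ y k (a + b).
Proof. by apply: pe_rel; left; exists (inord k), a, b. Qed.

Lemma y_far k l a b : (k < m.+1)%N -> (l < m.+1)%N -> (k.+1 < l)%N || (l.+1 < k)%N ->
  y k a ++ y l b ~ y l b ++ y k a.
Proof.
move=> km lm kl; apply: pe_rel; right; left; exists (inord k), (inord l), a, b.
by rewrite /far /= !inordK.
Qed.

Lemma y_A2 k a b c : (k.+1 < m.+1)%N ->
  y k a ++ y k.+1 b ++ y k c ~ y k.+1 c ++ y k (b + mul a c) ++ y k.+1 a.
Proof.
move=> km; apply: pe_rel; right; right.
by exists (inord k), (inord k.+1), a, b, c; rewrite /= !inordK // ltnW.
Qed.

Lemma y_braid k : (k.+1 < m.+1)%N ->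
  y k 0 ++ y k.+1 0 ++ y k 0 ~ y k.+1 0 ++ y k 0 ++ y k.+1 0.
Proof. by move=> km; rewrite y_A2 // mulz_l addr0. Qed.

Definition X (k : nat) (a : A) : word (BrAgen m.+2 A) := y k a ++ winv (y k 0).

Lemma y_X k a : y k a ~ X k a ++ y k 0.
Proof. by rewrite /X -catA mulVw cats0. Qed.

Lemma X0 k : X k 0 ~ [::].
Proof. exact: mulwV. Qed.

Lemma y_sq k a : y k 0 ++ y k 0 ++ y k a ~ y k a ++ y k 0 ++ y k 0.
Proof. by symmetry; have := y_A1 k a 0; rewrite addr0. Qed.

(** Multiply on the left by s_k^2. It commutes with y_k^a and cancels the inner inverse, which
    leaves the left side of (A1). *)
Lemma XD k a b : X k a ++ X k b ~ X k (a + b).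
Proof.
apply: (@wcancel_l _ _ (y k 0 ++ y k 0)); rewrite /X -!catA.
rewrite (catA (y k 0)) (catA (_ ++ _) (y k a)) -(catA (y k 0)) y_sq -!catA mulVKw.
by rewrite (catA (y k 0) (y k b)) (catA (y k a)) y_A1 -!catA.
Qed.

Lemma X_far k l b : (k < m.+1)%N -> (l < m.+1)%N -> (k.+1 < l)%N || (l.+1 < k)%N ->
  cj (y k 0) (X l b) ~ X l b.
Proof.
move=> km lm kl.
have yl a : cj (y k 0) (y l a) ~ y l a by apply/cjP/y_far.
by rewrite cjM cjV !yl.
Qed.

(** Both y_k^a and s_k centralize X_l(b), hence so does their quotient X_k(a). *)
Lemma X_comm k l a b : (k < m.+1)%N -> (l < m.+1)%N -> (k.+1 < l)%N || (l.+1 < k)%N ->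
  X k a ++ X l b ~ X l b ++ X k a.
Proof.
move=> km lm kl.
have yl c d : cj (y k c) (y l d) ~ y l d by apply/cjP/y_far.
have Xl c : cj (y k c) (X l b) ~ X l b by rewrite cjM cjV !yl.
by apply/cjP; rewrite cj_cat (cj_winv (Xl 0)).
Qed.

Lemma X_sq k a : cj (y k 0) (cj (y k 0) (X k a)) ~ X k a.
Proof.
have yk c : cj (y k 0 ++ y k 0) (y k c) ~ y k c by apply/cjP; rewrite -catA y_sq.
by rewrite -cj_cat cjM cjV !yk.
Qed.

(** By (A2) with its first two parameters 0, s_k s_{k+1} conjugates y_k^d to y_{k+1}^d for every d,
    in particular for [d = c] and [d = 0]. *)
Lemma X_up k c : (k.+1 < m.+1)%N -> cj (y k 0) (cj (y k.+1 0) (X k c)) ~ X k.+1 c.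
Proof.
move=> km.
have yk d : cj (y k 0 ++ y k.+1 0) (y k d) ~ y k.+1 d.
  by apply/cjP; rewrite -catA y_A2 // mulz_l addr0.
by rewrite -cj_cat cjM cjV !yk.
Qed.

Lemma X_down k a : (k.+1 < m.+1)%N -> cj (y k.+1 0) (cj (y k 0) (X k.+1 a)) ~ X k a.
Proof.
move=> km.
have yk d : cj (y k.+1 0 ++ y k 0) (y k.+1 d) ~ y k d.
  by apply/cjP; rewrite -catA y_A2 // mulz_r addr0.
by rewrite -cj_cat cjM cjV !yk.
Qed.

(** Right multiplication by s_{k+1} s_k s_{k+1} absorbs all inverses and leaves (A2) with its outer
    parameters 0. *)
Lemma X_next k b : (k.+1 < m.+1)%N -> cj (y k.+1 0) (X k b) ~ cj (y k 0) (X k.+1 b).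
Proof.
move=> km; apply: (@wcancel_r _ _ (y k.+1 0 ++ y k 0 ++ y k.+1 0)).
rewrite -{2}(y_braid km) -!cj_mul /X -!catA !mulKw.
by rewrite y_A2 // mulz_r addr0.
Qed.

(** The conjugate of X_k plays the part of x_{k,k+2}. Right multiplication by s_{k+1} s_k s_{k+1}
    supplies one s to each of the three factors, and the two sides become those of (A2). *)
Lemma X_A2 k a b c : (k.+1 < m.+1)%N ->
  X k a ++ cj (y k.+1 0) (X k b) ++ X k.+1 c ~
  X k.+1 c ++ cj (y k.+1 0) (X k (b + mul a c)) ++ X k a.
Proof.
move=> km; apply: (@wcancel_r _ _ (y k.+1 0 ++ y k 0 ++ y k.+1 0)).
rewrite -(catA (X k a)) -(catA (X k.+1 c)) -!(catA (cj _ _)) {1}X_next //.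
rewrite -{2}(y_braid km).
have up : X k.+1 c ++ y k.+1 0 ++ y k 0 ++ y k.+1 0 ~ y k 0 ++ y k.+1 0 ++ y k c.
  by rewrite catA -y_X y_A2 // mulz_l addr0.
have down : X k a ++ y k 0 ++ y k.+1 0 ++ y k 0 ~ y k.+1 0 ++ y k 0 ++ y k.+1 a.
  by rewrite catA -y_X y_A2 // mulz_r addr0.
rewrite up down -(cj_mul _ (y k 0)) -(cj_mul _ (y k.+1 0)).
rewrite 4!(catA (X _ _) (y _ 0)) -(y_X k a) -(y_X k.+1 b) -(y_X k.+1 c) -(y_X k (b + _)).
exact: y_A2.
Qed.

(* The preimage of x_{i+1,j+1}^a. *)
Definition elt (a : A) (i j : nat) : word (BrAgen m.+2 A) :=
  pair_elt (fun k => cj (y k 0)) (X^~ a) i j.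

Lemma elt_tnat a k i j : (k < m.+1)%N -> (i < m.+2)%N -> (j < m.+2)%N -> i != j ->
  cj (y k 0) (elt a i j) ~ elt a (tnat k i) (tnat k j).
Proof.
move=> km im jm ij; apply: (@pair_elt_tnat _ _ _ m.+1) => // {k i j km im jm ij}.
- by move=> k u v uv; rewrite uv.
- by move=> k l t kl; rewrite -!cj_cat y_far ?cj_cat //; lia.
- by move=> k t km; rewrite -!cj_cat -!catA y_braid // !cj_cat.
- by move=> k i km im ki; apply: X_far.
- by move=> i _; apply: X_sq.
- by move=> i im; apply: X_next.
- by move=> i im; apply: X_up.
- by move=> i im; apply: X_down.
Qed.

Lemma elt_transp a (k : 'I_m.+2.-1) (i j : 'I_m.+2) : i != j ->
  cj [:: yA k 0] (elt a i j) ~ elt a (transp k i) (transp k j).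
Proof.
by move=> ij; rewrite !transp_val -elt_tnat // /y inord_val.
Qed.

(** One word [w] serves all parameters and all pairs, so a whole relation can be transported at
    once. *)
Lemma elt_perm (s : {perm 'I_m.+2}) : exists w, forall a (i j : 'I_m.+2), i != j ->
  cj w (elt a i j) ~ elt a (s i) (s j).
Proof.
elim/transp_ind: s => [|s t [w ws] [w' wt]|k].
- by exists [::] => a i j _; rewrite !perm1 /cj cats0.
- exists (w' ++ w) => a i j ij.
  by rewrite !permM cj_cat ws // wt // (inj_eq perm_inj).
- by exists [:: yA k 0] => a i j; apply: elt_transp.
Qed.

(** * Steinberg relations among the [elt], each checked on the first indices *)

Lemma eltD a b (i j : 'I_m.+2) : i != j -> elt a i j ++ elt b i j ~ elt (a + b) i j.
Proof.
move=> ij; have [|s [s0 s1]] := @perm_to_iota _ [:: i; j]; first by rewrite /= inE ij.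
have [w ws] := elt_perm s; apply: (@cj_inj _ _ w).
by rewrite cjM !ws // s0 s1; apply: XD.
Qed.

Lemma elt_commutator a b (i j k : 'I_m.+2) : uniq [:: i; j; k] ->
  elt a i j ++ elt b j k ~ elt b j k ++ elt (mul a b) i k ++ elt a i j.
Proof.
move=> ijk; have [s [s0 s1 s2]] := perm_to_iota ijk.
(* The third index is sent to 2, so the braid generators 0 and 1 both exist. *)
have m2 : (1 < m.+1)%N by have := ltn_ord (s k); lia.
move: ijk; rewrite /= !inE negb_or andbT => /andP[/andP[ij ik] jk].
have [w ws] := elt_perm s; apply: (@cj_inj _ _ w).
rewrite !cjM !ws // s0 s1 s2.
(* A zero middle parameter leaves only the product term on the pair (0, 2). *)
have := @X_A2 0 a 0 b m2; rewrite X0 add0r => <-.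
by rewrite [cj _ [::]]mulwV.
Qed.

Lemma elt_comm_row a b (i j k : 'I_m.+2) : uniq [:: i; j; k] ->
  elt a i j ++ elt b i k ~ elt b i k ++ elt a i j.
Proof.
move=> ijk; have [s [s0 s1 s2]] := perm_to_iota ijk.
have m2 : (1 < m.+1)%N by have := ltn_ord (s k); lia.
move: ijk; rewrite /= !inE negb_or andbT => /andP[/andP[ij ik] jk].
have [w ws] := elt_perm s; apply: (@cj_inj _ _ w).
rewrite !cjM !ws // s0 s1 s2.
(* A zero last parameter leaves the pairs (0, 1) and (0, 2). *)
by have := @X_A2 0 a b 0 m2; rewrite X0 mulz_r addr0 cats0.
Qed.

Lemma elt_comm_col a b (i j k : 'I_m.+2) : uniq [:: i; j; k] ->
  elt a i k ++ elt b j k ~ elt b j k ++ elt a i k.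
Proof.
move=> ijk; have [s [s0 s1 s2]] := perm_to_iota ijk.
have m2 : (1 < m.+1)%N by have := ltn_ord (s k); lia.
move: ijk; rewrite /= !inE negb_or andbT => /andP[/andP[ij ik] jk].
have [w ws] := elt_perm s; apply: (@cj_inj _ _ w).
rewrite !cjM !ws // s0 s1 s2.
(* A zero first parameter leaves the pairs (0, 2) and (1, 2). *)
by have := @X_A2 0 0 a b m2; rewrite X0 mulz_l addr0 cats0.
Qed.

Lemma elt_comm_disjoint a b (i j k l : 'I_m.+2) : uniq [:: i; j; k; l] ->
  elt a i j ++ elt b k l ~ elt b k l ++ elt a i j.
Proof.
move=> ijkl; have [s [s0 s1 s2 s3]] := perm_to_iota ijkl.
have m3 : (2 < m.+1)%N by have := ltn_ord (s l); lia.
move: ijkl; rewrite /= !inE !negb_or andbT => /and3P[/and3P[ij _ _] _ kl].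
have [w ws] := elt_perm s; apply: (@cj_inj _ _ w).
by rewrite !cjM !ws // s0 s1 s2 s3; apply: X_comm.
Qed.

(** * The inverse map [psi] *)

Definition psi_St (g : Stgen m.+2 A) := elt g.2 (val g.1).1 (val g.1).2.
Definition psi_Br (i : 'I_m.+2.-1) : word (BrAgen m.+2 A) := [:: yA i 0].
Definition psi (p : SD m.+2 A) := wmap psi_St p.1 ++ wmap psi_Br p.2.

Lemma psi_St_eq u v : St_eq mul u v -> wmap psi_St u ~ wmap psi_St v.
Proof.
apply: wmap_pres_eq => {}u {}v.
case=> [[p [a [b [-> ->]]]]|[[p [q [a [b [pq [qp [-> ->]]]]]]]|
        [p [q [r [a [b [pq [rE [-> ->]]]]]]]]]];
  rewrite /wmap /= !cats0 /psi_St /=.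
- by apply: eltD; case: p.
- case: p q => [[i j] /= ij] [[k l] /= kl] in pq qp *; rewrite /= in pq qp.
  (* The commutation relation covers four configurations: equal pairs, a common first index, a
     common second index, four distinct indices. *)
  have [ik|ik] := eqVneq i k; have [jl|jl] := eqVneq j l; subst.
  + by rewrite !eltD // addrC.
  + by apply: elt_comm_row; rewrite /= !inE negb_or ij kl jl.
  + by apply: elt_comm_col; rewrite /= !inE negb_or ik ij kl.
  + by apply: elt_comm_disjoint; rewrite /= !inE !negb_or ij ik pq qp jl kl.
- rewrite rE /=; case: p q rE => [[i j] /= ij] [[k l] /= kl] rE in pq *.
  rewrite /= in pq rE; subst k; apply: elt_commutator.
  by case: r rE => [[i' l'] /= il] [ii ll]; subst; rewrite /= !inE negb_or ij il kl.
Qed.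

Lemma psi_Br_eq u v : Br_eq u v -> wmap psi_Br u ~ wmap psi_Br v.
Proof.
apply: wmap_pres_eq => {}u {}v.
case=> [[i [j [ij [-> ->]]]]|[i [j [ij [-> ->]]]]]; apply: pe_rel; right; [left|right].
  by exists i, j, 0, 0.
by exists i, j, 0, 0, 0; rewrite mulz_l addr0.
Qed.

Lemma psi_eq p q : SD_eq mul p q -> psi p ~ psi q.
Proof. by case=> pq1 pq2; apply: pe_cat; [apply: psi_St_eq|apply: psi_Br_eq]. Qed.

(** Conjugation by the image of a braid realizes its action, which is what makes [psi]
    multiplicative on the semidirect product. *)
Lemma psi_St_act b g : cj (wmap psi_Br b) (psi_St g) ~ psi_St (act_gen b g).
Proof.
elim: b => [|[k e] b IH]; first by rewrite /cj /= cats0.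
rewrite wmap_cons cj_cat IH /=; move: (act_gen b g) => {IH}[p a].
have tE q : cj [:: yA k 0] (psi_St (q, a)) ~ psi_St (perm_gen (transp k) (q, a)).
  by rewrite perm_genE /psi_St perm_idxE /=; apply: elt_transp; case: q.
case: e; last by rewrite wmap1 -tE.
rewrite -[[:: (k, true)]]/(winv [:: (k, false)]) wmap_winv wmap1.
by apply: cj_winv; rewrite perm_genE tE perm_genE perm_idxM tperm2 perm_idx1.
Qed.

Lemma psi_mul p q : psi (SD_mul p q) ~ psi p ++ psi q.
Proof.
rewrite /psi /= !wmap_cat -(cj_wmap (psi_St_act p.2)).
by rewrite -!(catA (wmap psi_St p.1)) -cj_mul.
Qed.

Lemma psi_inv p : psi (SD_inv p) ~ winv (psi p).
Proof.
apply: (@wcancel_l _ _ (psi p)); rewrite -psi_mul mulwV.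
exact: (psi_eq (SD_mulpV mul p)).
Qed.

Lemma phiK u : psi (phi u) ~ u.
Proof.
elim: u => [//|[g e] u IH].
rewrite -[phi _]/(SD_mul (phi_letter (g, e)) (phi u)) psi_mul IH -cat1s.
(* On a generator this reads X_k(a) s_k = y_k^a. *)
have genK : psi (phi_gen g) ~ [:: (g, false)].
  case: g => k a; have -> : psi (phi_gen (k, a)) = X k a ++ y k 0.
    by rewrite /psi /= !wmap1 /psi_St /elt /pair_elt /= ltnSn subnn /= /y inord_val.
  by rewrite -y_X /y inord_val.
apply: pe_cat => //; case: e; last exact: genK.
by rewrite /phi_letter /= psi_inv genK.
Qed.

Lemma phi_inj u v : SD_eq mul (phi u) (phi v) -> u ~ v.
Proof. by move/psi_eq; rewrite !phiK. Qed.

(** * Surjectivity: the image of [phi] is a subgroup containing both factors *)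

Definition in_phi p := exists u : word (BrAgen m.+2 A), SD_eq mul (phi u) p.

Lemma in_phi_mul p q : in_phi p -> in_phi q -> in_phi (SD_mul p q).
Proof.
by move=> [u up] [v vq]; exists (u ++ v); rewrite phi_cat up vq; reflexivity.
Qed.

Lemma in_phi_eq p q : SD_eq mul p q -> in_phi p -> in_phi q.
Proof. by move=> pq [u up]; exists u; rewrite up. Qed.

Lemma in_phi_inv p : in_phi p -> in_phi (SD_inv p).
Proof.
move=> [u up]; exists (winv u).
rewrite -[phi _]SD_mul1p -(SD_mulVp mul p) -SD_mulA -{2}up -phi_cat.
by rewrite (phi_eq (mulwV _ u)) SD_mulp1; reflexivity.
Qed.

Lemma in_phi_Br (b : word 'I_m.+2.-1) : in_phi ([::], b).
Proof.
have in1 k : in_phi ([::], [:: (k, false)]).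
  by exists [:: yA k 0]; split=> //=; apply: St_x0.
elim: b => [|[k e] b IH]; first by exists [::]; reflexivity.
rewrite -[([::], _)]/(SD_mul ([::], [:: (k, e)]) ([::], b)); apply: in_phi_mul => //.
by case: e; [exact: (in_phi_inv (in1 k))|exact: in1].
Qed.

Lemma in_phi_x p a : in_phi ([:: xA p a], [::]).
Proof.
(* Conjugating x_{s(q)}^a by y_k, with s the transposition of k, gives x_q^a, so membership can be
   pulled back along any permutation. *)
have in_act (s : {perm 'I_m.+2}) q :
    in_phi ([:: xA (perm_idx s q) a], [::]) -> in_phi ([:: xA q a], [::]).
  elim/transp_ind: s q => [q|s t IHs IHt q|k q]; first by rewrite perm_idx1.
    by rewrite -perm_idxM => /IHt/IHs.
  move=> tq; have := in_phi_mul (in_phi_mul (in_phi_Br [:: (k, false)]) tq)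
                       (in_phi_Br [:: (k, true)]).
  apply: in_phi_eq; split; last exact: pe_cancel.
  by rewrite /= perm_genE perm_idxM tperm2 perm_idx1.
have [|s [s0 s1]] := @perm_to_iota _ [:: (val p).1; (val p).2].
  by rewrite /= inE andbT; case: p.
apply: (in_act s); pose k0 : 'I_m.+2.-1 := @ord0 m.
have -> : perm_idx s p = xpair k0.
  by apply: val_inj; rewrite perm_idxE; congr pair; apply: val_inj.
(* This is [phi] of y_0^a; multiplying by y_0^-1 on the right strips the braid letter. *)
have : in_phi ([:: xA (xpair k0) a], [:: (k0, false)]).
  by exists [:: yA k0 a]; split.
move/in_phi_mul/(_ (in_phi_Br [:: (k0, true)])); apply: in_phi_eq.
by split=> //=; apply: pe_cancel.
Qed.

Lemma phi_surj p : in_phi p.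
Proof.
case: p => u b; have -> : (u, b) = SD_mul (u, [::]) ([::], b) by rewrite /SD_mul /= cats0.
apply: in_phi_mul; last exact: in_phi_Br.
elim: u => [|[[p a] e] u IH]; first exact: in_phi_Br.
(* With trivial braid part the action is trivial, so concatenation is a product in the semidirect
   product. *)
rewrite -[u]act_word_nil -[_ :: _]cat1s.
apply: (@in_phi_mul ([:: (p, a, e)], [::]) (u, [::])) => //.
by case: e; [exact: (in_phi_inv (in_phi_x p a))|exact: in_phi_x].
Qed.

End Inverse.

Theorem theorem2p8 (A : zmodType) (mul : A -> A -> A)
  (mulA : associative mul)
  (mulDl : left_distributive mul +%R) (mulDr : right_distributive mul +%R)
  (n : nat) (hn : (2 <= n)%N) :
  (* phi is well defined on Br_n(A) *)
  (forall u v : word (BrAgen n A),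
      BrA_eq mul u v -> SD_eq mul (phi u) (phi v)) /\
  (* phi is a group homomorphism *)
  (forall u v : word (BrAgen n A),
      SD_eq mul (phi (u ++ v)) (SD_mul (phi u) (phi v))) /\
  (* phi is injective *)
  (forall u v : word (BrAgen n A),
      SD_eq mul (phi u) (phi v) -> BrA_eq mul u v) /\
  (* phi is surjective *)
  (forall p : SD n A, exists u : word (BrAgen n A), SD_eq mul (phi u) p).
Proof.
case: n hn => [|[|m]] // _; split; first exact: phi_eq.
split; first by move=> u v; rewrite phi_cat; apply: SD_eq_refl.
by split; [exact: phi_inj | exact: phi_surj].
Qed.
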